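(* Let $G_1$ be a graph of order $m_1$ having no pair of false twins, and let $G_2$ be the star graph $K_{1,m_2}$ of order $m_2+1$. Then $\mathrm{fix}(G_1*G_2)=m_1(m_2-1)+\mathrm{fix}(G_1)$.
   Context: All graphs are finite and simple. For graphs $G_1,G_2$, the co-normal product $G_1*G_2$ is the graph with vertex set $V(G_1)\times V(G_2)$ in which $(a,b)$ and $(c,d)$ are adjacent if and only if $a$ is adjacent to $c$ in $G_1$ or $b$ is adjacent to $d$ in $G_2$. Two distinct vertices $u,v$ are false twins if $N(u)=N(v)$ (open neighborhoods). A set $F\subseteq V(G)$ is a fixing set of $G$ if the only automorphism of $G$ fixing every vertex of $F$ is the identity; $\mathrm{fix}(G)$ is the minimum cardinality of a fixing set.
   Formalization: The star K_{1,m_2} is assumed to have m_2 ≥ 2; for m_2 = 1 the formula fails (G_1 = K_1 gives G_1*G_2 = K_2 with fixing number 1, while the formula gives 0), and it fails likewise for m_2 = 0. *)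

(* Defs.v *)
From mathcomp Require Import all_boot all_fingroup.
Set Implicit Arguments.
Unset Strict Implicit.
Unset Printing Implicit Defensive.

Record sgraph := SGraph {
  vertex :> finType;
  adj : rel vertex;
  adj_sym : symmetric adj;
  adj_irrefl : irreflexive adj }.

Arguments adj {s}.

Section ConormalProduct.
Variables G1 G2 : sgraph.

Definition conormal_adj : rel (G1 * G2) :=
  fun x y => adj x.1 y.1 || adj x.2 y.2.

Lemma conormal_adj_sym : symmetric conormal_adj.
Proof.
by move=> x y; rewrite /conormal_adj (adj_sym x.1) (adj_sym x.2).
Qed.

Lemma conormal_adj_irrefl : irreflexive conormal_adj.
Proof. by move=> x; rewrite /conormal_adj !adj_irrefl. Qed.

Definition conormal_product : sgraph :=
  SGraph conormal_adj_sym conormal_adj_irrefl.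

End ConormalProduct.

Section CompleteBipartite.
Variables m n : nat.

Definition complete_bipartite_adj : rel ('I_m + 'I_n) :=
  fun x y => match x, y with
             | inl _, inr _ | inr _, inl _ => true
             | _, _ => false
             end.

Lemma complete_bipartite_adj_sym : symmetric complete_bipartite_adj.
Proof. by case=> ? []. Qed.

Lemma complete_bipartite_adj_irrefl : irreflexive complete_bipartite_adj.
Proof. by case. Qed.

Definition complete_bipartite : sgraph :=
  SGraph complete_bipartite_adj_sym complete_bipartite_adj_irrefl.

End CompleteBipartite.

(* The formula for the fixing number of G * K_{1,n} fails for the degenerate
   stars: K_1 * K_{1,1} = K_2 has fixing number 1, not 1 * (1 - 1) + 0.  Hence
   the hypothesis 2 <= n wherever it is stated. *)
Definition star (n : nat) : sgraph := complete_bipartite 1 n.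

Section FixingNumber.
Variable G : sgraph.

Definition nbhd (u : G) : {set G} := [set v | adj u v].

Definition false_twins (u v : G) : bool := (u != v) && (nbhd u == nbhd v).

Definition is_automorphism (p : {perm G}) : bool :=
  [forall u, forall v, adj (p u) (p v) == adj u v].

Definition is_fixing_set (F : {set G}) : bool :=
  [forall p : {perm G},
     is_automorphism p && [forall u in F, p u == u] ==> (p == 1%g)].

(* [fixing_number] is a genuine minimum because the seed [set: G] of the
   arg min is itself a fixing set. *)
Lemma is_fixing_setT : is_fixing_set [set: G].
Proof.
apply/forallP=> p; apply/implyP=> /andP[_ /forall_inP pT].
by apply/eqP/permP=> u; rewrite perm1; apply/eqP/pT; rewrite inE.
Qed.

Definition fixing_number : nat :=
  #|[arg min_(F < [set: G] | is_fixing_set F) #|F|]|.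

End FixingNumber.

(* Main.v *)
(** Two vertices [(a, x)], [(b, y)] of [G1 * K_(1,m2)] are non-adjacent only if
    [x], [y] are both the center or both leaves, so the product is the join of a
    copy of [G1] (the center layer) and of [G1] with every vertex replaced by
    [m2] false twins [(a, i)].  Swapping false twins is an automorphism, so a
    fixing set omits at most one leaf copy of each [a]; every automorphism of
    [G1] acts on the center layer alone, so the trace of a fixing set there is
    a fixing set of [G1].  Conversely, since [G1] has no false twins, fixing all
    leaf copies but one of each [a] forces the omitted one to be fixed, and what
    remains is an automorphism of the center layer. *)
Require Import Defs.
From mathcomp Require Import all_boot all_fingroup.
Set Implicit Arguments.
Unset Strict Implicit.
Unset Printing Implicit Defensive.

Section FixingSets.
Variable G : sgraph.

Lemma automorphismP (p : {perm G}) :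
  reflect (forall u v, adj (p u) (p v) = adj u v) (is_automorphism p).
Proof.
apply: (iffP forallP) => [pA u v|pA u]; first exact/eqP/(forallP (pA u)).
by apply/forallP=> v; rewrite pA.
Qed.

Lemma fixing_setP (F : {set G}) :
  reflect (forall p : {perm G}, is_automorphism p ->
             {in F, forall u, p u = u} -> p = 1%g)
          (is_fixing_set F).
Proof.
apply: (iffP forallP) => [fixF p pA pF|fixF p].
  apply/eqP; move/implyP: (fixF p); apply; rewrite pA /=.
  by apply/forall_inP=> u /pF->.
apply/implyP=> /andP[pA /forall_inP pF]; apply/eqP/fixF => // u /pF.
by move/eqP.
Qed.

Lemma fixing_number_le (F : {set G}) : is_fixing_set F -> fixing_number G <= #|F|.
Proof.
by rewrite /fixing_number; case: arg_minnP => [|F0 _ minF0 /minF0 //];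
  exact: is_fixing_setT.
Qed.

Lemma fixing_number_attained :
  exists2 F : {set G}, is_fixing_set F & #|F| = fixing_number G.
Proof.
rewrite /fixing_number; case: arg_minnP => [|F fixF _]; last by exists F.
exact: is_fixing_setT.
Qed.

Lemma nbhd_eqP (u v : G) : reflect (adj u =1 adj v) (nbhd u == nbhd v).
Proof.
apply: (iffP eqP) => [/setP Nuv w|Nuv]; first by have := Nuv w; rewrite !inE.
by apply/setP=> w; rewrite !inE.
Qed.

Lemma automorphism_twins (p : {perm G}) (u v : G) :
  is_automorphism p -> adj u =1 adj v -> adj (p u) =1 adj (p v).
Proof.
by move=> /automorphismP pA Nuv w; rewrite -(permKV p w) !pA.
Qed.

Lemma tperm_automorphism (u v : G) :
  adj u =1 adj v -> is_automorphism (tperm u v).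
Proof.
move=> Nuv; have Nt w : adj (tperm u v w) =1 adj w.
  by move=> z; case: tpermP => [->|->|//]; rewrite Nuv.
(* [Nt] removes the transposition from the left argument only; symmetry brings the right one into
   its reach. *)
by apply/automorphismP=> w z; rewrite Nt adj_sym Nt adj_sym.
Qed.

(** Otherwise the transposition of [u] and [v] would be a nontrivial automorphism fixing [F]
    pointwise. *)
Lemma fixing_set_twins (F : {set G}) (u v : G) :
  is_fixing_set F -> adj u =1 adj v -> u \notin F -> v \notin F -> u = v.
Proof.
move=> /fixing_setP fixF Nuv uF vF.
have /permP/(_ u) : tperm u v = 1%g.
  apply: fixF (tperm_automorphism Nuv) _ => w wF.
  by rewrite tpermD //; apply: contraTneq wF => <-.
by rewrite tpermL perm1.
Qed.

End FixingSets.

Section ConormalStar.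
Variables (G1 : sgraph) (n : nat).
Local Notation P := (conormal_product G1 (star n)).

Definition center_vertex (a : G1) : P := (a, inl ord0).
Definition leaf_vertex (a : G1) (i : 'I_n) : P := (a, inr i).

Lemma star_vertexP (x : P) :
  (exists a, x = center_vertex a) \/ (exists a i, x = leaf_vertex a i).
Proof.
by case: x => a [c|i]; [left; exists a; rewrite (ord1 c)|right; exists a, i].
Qed.

Lemma adj_center a b : adj (center_vertex a) (center_vertex b) = adj a b.
Proof. exact: orbF. Qed.

Lemma adj_leaf a i b j : adj (leaf_vertex a i) (leaf_vertex b j) = adj a b.
Proof. exact: orbF. Qed.

Lemma adj_center_leaf a b j : adj (center_vertex a) (leaf_vertex b j).
Proof. exact: orbT. Qed.

Lemma adj_leaf_center a i b : adj (leaf_vertex a i) (center_vertex b).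
Proof. exact: orbT. Qed.

Lemma leaf_twins a i j : adj (leaf_vertex a i) =1 adj (leaf_vertex a j).
Proof. by case=> b []. Qed.

Definition center_trace (F : {set P}) : {set G1} :=
  [set a | center_vertex a \in F].

Definition leaf_trace (F : {set P}) (a : G1) : {set 'I_n} :=
  [set i | leaf_vertex a i \in F].

Lemma card_traces (F : {set P}) :
  #|F| = #|center_trace F| + \sum_a #|leaf_trace F a|.
Proof.
rewrite -sum1dep_card big_mkcond -big_split -sum1_card big_mkcond /=.
transitivity (\sum_(a : G1) \sum_(y : 'I_1 + 'I_n) ((a, y) \in F : nat)).
  by rewrite pair_bigA; apply: eq_bigr => -[a y] _ /=; case: (_ \in F).
apply: eq_bigr => a _; rewrite big_sumType big_ord1 /=; congr (_ + _).
by rewrite -sum1dep_card [RHS]big_mkcond; apply: eq_bigr => i _; case: (_ \in F).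
Qed.

Definition center_lift_fun (q : {perm G1}) (x : P) : P :=
  if x.2 is inl _ then (q x.1, x.2) else x.

Lemma center_lift_fun_inj q : injective (center_lift_fun q).
Proof.
by case=> a [c|i] [b [d|j]] //= [] /perm_inj-> ->.
Qed.

Definition center_lift q : {perm P} := perm (@center_lift_fun_inj q).

(** Center and leaf layers are completely joined, so permuting the center layer alone preserves
    every edge between them. *)
Lemma center_lift_automorphism q :
  is_automorphism q -> is_automorphism (center_lift q).
Proof.
move=> /automorphismP qA; apply/automorphismP=> -[a [c|i]] [b [d|j]];
  rewrite !permE //= /conormal_adj /= ?orbT //.
by rewrite qA.
Qed.

Lemma center_trace_fixing (F : {set P}) :
  is_fixing_set F -> is_fixing_set (center_trace F).
Proof.
move=> /fixing_setP fixF; apply/fixing_setP=> q qA qF.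
have q1 : center_lift q = 1%g.
  apply: fixF (center_lift_automorphism qA) _ => x.
  case: (star_vertexP x) => [[a ->] aF|[a [i ->]] _]; rewrite permE //.
  by rewrite /center_lift_fun /= qF // inE.
apply/permP=> a; have /permP/(_ (center_vertex a)) := q1.
by rewrite permE !perm1 => -[].
Qed.

Lemma leaf_trace_card (F : {set P}) a :
  is_fixing_set F -> n - 1 <= #|leaf_trace F a|.
Proof.
(* The bound amounts to the complement of the trace having at most one element, as its elements
   index twins outside [F]. *)
move=> fixF; rewrite leq_subLR -[leqLHS](card_ord n) -(cardsC (leaf_trace F a)).
rewrite addnC leq_add2r; apply/card_le1_eqP=> i j; rewrite !inE => iF jF.
by case: (fixing_set_twins fixF (@leaf_twins a i j) iF jF).
Qed.

Lemma fixing_number_star_ge :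
  #|G1| * (n - 1) + fixing_number G1 <= fixing_number P.
Proof.
have [F fixF <-] := fixing_number_attained P; rewrite card_traces addnC.
rewrite leq_add ?fixing_number_le ?center_trace_fixing //.
by rewrite -sum_nat_const leq_sum // => a _; apply: leaf_trace_card.
Qed.

Hypothesis noFT : forall u v : G1, ~~ false_twins u v.

Lemma nbhd_inj (a b : G1) : adj a =1 adj b -> a = b.
Proof.
by move=> /nbhd_eqP Nab; have := noFT a b; rewrite /false_twins Nab andbT => /negPn/eqP.
Qed.

(** A center vertex is adjacent to [leaf_vertex a i], which is not adjacent to itself, so [x] is a
    leaf vertex. Testing against other leaf vertices recovers adjacency in [G1], where the absence
    of false twins determines the first coordinate. *)
Lemma leaf_twin_inv x a i :
  adj x =1 adj (leaf_vertex a i) -> exists j, x = leaf_vertex a j.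
Proof.
case: (star_vertexP x) => [[b ->]|[b [j ->]]] Nx.
  by have := Nx (leaf_vertex a i); rewrite adj_center_leaf adj_irrefl.
exists j; congr leaf_vertex; apply: nbhd_inj => c.
by rewrite -(adj_leaf b j c j) Nx adj_leaf.
Qed.

(** Each leaf vertex is already its own image, so injectivity keeps [p] from sending a center vertex
    to a leaf. *)
Lemma center_perm (p : {perm P}) :
  (forall a i, p (leaf_vertex a i) = leaf_vertex a i) ->
  exists q : {perm G1}, forall a, p (center_vertex a) = center_vertex (q a).
Proof.
move=> pL; have pC a : p (center_vertex a) = center_vertex (p (center_vertex a)).1.
  have [[b -> //]|[b [i pa]]] := star_vertexP (p (center_vertex a)).
  by move: pa; rewrite -(pL b i) => /perm_inj.
have q_inj : injective (fun a => (p (center_vertex a)).1).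
  by move=> a b /(congr1 center_vertex); rewrite -!pC => /perm_inj[].
by exists (perm q_inj) => a; rewrite permE -pC.
Qed.

(** Omitting the single copy [i0] over each vertex is the most that the lower bound permits. *)
Definition extend_fixing_set (F : {set G1}) (i0 : 'I_n) : {set P} :=
  [set x : P | match x.2 with inl _ => x.1 \in F | inr i => i != i0 end].

Lemma card_extend_fixing_set F i0 :
  #|extend_fixing_set F i0| = #|G1| * (n - 1) + #|F|.
Proof.
rewrite card_traces addnC -sum_nat_const; congr (_ + _).
  apply: eq_bigr => a _; rewrite -[in RHS](card_ord n) subn1 -cardsT.
  rewrite (cardsD1 i0) inE /=; apply: eq_card => i.
  by rewrite !inE andbT.
by apply: eq_card => a; rewrite !inE.
Qed.

Lemma extend_fixing_setP F i0 i1 :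
  i1 != i0 -> is_fixing_set F -> is_fixing_set (extend_fixing_set F i0).
Proof.
move=> i10 /fixing_setP fixF; apply/fixing_setP=> p pA pF.
have pL' a i : i != i0 -> p (leaf_vertex a i) = leaf_vertex a i.
  by move=> ni0; apply: pF; rewrite inE.
have pL a i : p (leaf_vertex a i) = leaf_vertex a i.
  have [->|/pL' //] := eqVneq i i0.
  (* The fixed copy [i1] anchors the omitted one: the image of copy [i0] is a twin of copy [i1],
     hence some copy [j] of the same [a]. If [j] differs from [i0], copy [j] is fixed too, against
     injectivity. *)
  have Np := automorphism_twins pA (@leaf_twins a i0 i1).
  rewrite (pL' a i1) // in Np; have [j pj] := leaf_twin_inv Np.
  have [j0|nj0] := eqVneq j i0; first by rewrite pj j0.
  by have := pj; rewrite -(pL' a j nj0) => /perm_inj->; rewrite !pL'.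
have [q pq] := center_perm pL.
have q1 : q = 1%g.
  apply: fixF => [|a aF].
    apply/automorphismP=> a b; rewrite -adj_center -!pq.
    by rewrite (automorphismP _ pA) adj_center.
  by have: p (center_vertex a) = center_vertex a;
    [apply: pF; rewrite inE|rewrite pq => -[]].
apply/permP=> x; rewrite perm1.
by case: (star_vertexP x) => [[a ->]|[a [i ->]]] //; rewrite pq q1 perm1.
Qed.

Lemma fixing_number_star_le :
  1 < n -> fixing_number P <= #|G1| * (n - 1) + fixing_number G1.
Proof.
move=> n_gt1; have [F fixF <-] := fixing_number_attained G1.
(* Copy 0 is omitted and copy 1 is the anchor; this is where two leaves are required. *)
rewrite -(card_extend_fixing_set F (Ordinal (ltnW n_gt1))).
by apply/fixing_number_le/(@extend_fixing_setP _ _ (Ordinal n_gt1)).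
Qed.

End ConormalStar.

Theorem theorem3p15 (G1 : sgraph) (m1 m2 : nat) (hm1 : #|G1| = m1)
    (hm2 : 2 <= m2) (hG1 : forall u v : G1, ~~ false_twins u v) :
  fixing_number (conormal_product G1 (star m2)) =
    m1 * (m2 - 1) + fixing_number G1.
Proof.
rewrite -hm1; apply/eqP.
by rewrite eqn_leq fixing_number_star_le // fixing_number_star_ge.
Qed.
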